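(* There are universal constants $c,C>0$ such that for every $n\ge1$ and every read-once formula $f:\{0,1\}^n\to\{0,1\}$ on $n$ variables, $c\sqrt n\le \widetilde{\deg}(f)\le C\sqrt n$.
   Context: A read-once formula is a Boolean formula over the De Morgan basis (AND, OR, NOT gates, arbitrary fan-in for AND/OR) in which each of the $n$ variables appears exactly once. A real polynomial $q$ $1/3$-approximates $f$ if $q(x)\in[0,1/3]$ for $x\in f^{-1}(0)$ and $q(x)\in[2/3,1]$ for $x\in f^{-1}(1)$; $\widetilde{\deg}(f)$ is the minimum degree of such a polynomial. *)

(* Defs.v *)
From mathcomp Require Import all_boot all_algebra.
From mathcomp Require Import mpoly.
From mathcomp Require Import Rstruct.
From Stdlib Require Import Reals.

Set Implicit Arguments.
Unset Strict Implicit.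
Unset Printing Implicit Defensive.
Import GRing.Theory Num.Theory.

Inductive formula (n : nat) : Type :=
| FVar of 'I_n
| FNot of formula n
| FAnd of seq (formula n)
| FOr  of seq (formula n).

Arguments FVar {n}.
Arguments FNot {n}.
Arguments FAnd {n}.
Arguments FOr {n}.

Fixpoint feval n (x : 'I_n -> bool) (phi : formula n) : bool :=
  match phi with
  | FVar i => x i
  | FNot g => ~~ feval x g
  | FAnd gs => all (feval x) gs
  | FOr gs => has (feval x) gs
  end.

Fixpoint fleaves n (phi : formula n) : seq 'I_n :=
  match phi with
  | FVar i => [:: i]
  | FNot g => fleaves g
  | FAnd gs => flatten (map (@fleaves n) gs)
  | FOr gs => flatten (map (@fleaves n) gs)
  end.

(* every AND / OR gate has at least one input (gates are genuine gates,
   not hidden constants) *)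
Fixpoint fwf n (phi : formula n) : bool :=
  match phi with
  | FVar _ => true
  | FNot g => fwf g
  | FAnd gs => (~~ nilp gs) && all (@fwf n) gs
  | FOr gs => (~~ nilp gs) && all (@fwf n) gs
  end.

Definition read_once n (phi : formula n) : bool :=
  fwf phi && perm_eq (fleaves phi) (enum 'I_n).

Local Open Scope ring_scope.

(* total degree of a real multivariate polynomial (deg 0 := 0) *)
Definition mdegree n (q : {mpoly R[n]}) : nat := (msize q).-1.

Definition approximates n (q : {mpoly R[n]}) (f : ('I_n -> bool) -> bool) : Prop :=
  forall x : 'I_n -> bool,
    let v := q.@[fun i => (x i)%:R] in
    if f x then 2%:R / 3%:R <= v /\ v <= 1
    else 0 <= v /\ v <= 1 / 3%:R.

(* Main.v *)
(* Upper bound.  A read-once formula on n variables has a feasible solution of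
   value sqrt n of the dual adversary semidefinite program, by a lossless
   recursion over binary conjunctions and negations.  It yields a reflection S
   and a diagonal sign matrix D_x, affine in x, such that U = D_x S fixes a
   vector with constant overlap with the starting vector e when f(x) = 1, while
   e = (w - U w) / 2 with |w| = O(sqrt n) when f(x) = 0.  Hence the squared norm
   of the average of U^t e over t < T = O(sqrt n), a polynomial in x of degree
   less than 2 T, is bounded below in the first case, and small in the second,
   where the sum telescopes.

   Lower bound.  The spectral sensitivity of f, i.e. the norm of the adjacency
   matrix of the cube restricted to the edges between f^-1(0) and f^-1(1), is at
   least sqrt n, by an equally lossless recursion.  Let A, B >= 0 be unit vectors
   on f^-1(0), f^-1(1) witnessing this, up to signs, and let R_t rotate every bit
   by t/2.  For an approximant q of degree d, t |-> <R_t A, q R_t B> is a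
   trigonometric polynomial of degree d bounded by 1, whose derivative at 0 is
   half the sum of A(x) B(y) (q(y) - q(x)) over the edges (x, y), so at least
   sqrt n / 6.  Bernstein's inequality then gives d >= sqrt n / 6. *)

Require Import Defs.
From mathcomp Require Import all_boot all_algebra.
From mathcomp Require Import order.
From mathcomp Require Import zify mpoly polyrcf.
From mathcomp Require Import Rstruct.
From Stdlib Require Import Reals FunctionalExtensionality.
From mathcomp Require Import ring lra.
Import GRing.Theory Num.Theory Order.TTheory.
Set Implicit Arguments.
Unset Strict Implicit.
Unset Printing Implicit Defensive.
Local Open Scope ring_scope.

(** * Induction over read-once formulas *)

Lemma formula_nested_ind n (P : formula n -> Prop) :
  (forall i, P (FVar i)) -> (forall g, P g -> P (FNot g)) ->
  (forall gs, foldr (fun g => and (P g)) True gs -> P (FAnd gs)) ->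
  (forall gs, foldr (fun g => and (P g)) True gs -> P (FOr gs)) ->
  forall phi, P phi.
Proof.
(* The generated principle gives no hypothesis for the members of a gate's list, so the recursion is
   written by hand and the inner list inductions call [IH] on each member. *)
move=> Pvar Pnot Pand Por; fix IH 1 => -[i|g|gs|gs].
- exact: Pvar.
- exact/Pnot/IH.
- by apply: Pand; elim: gs => //= g gs IHgs; split.
- by apply: Por; elim: gs => //= g gs IHgs; split.
Qed.

Lemma size_fleaves_gt0 n (phi : formula n) : fwf phi -> (0 < size (fleaves phi))%nat.
Proof.
elim/formula_nested_ind: phi => //= -[//|g gs] /= [IHg _] /andP[/IHg + _];
  by rewrite size_cat; case: size.
Qed.

(* A read-once formula is built from variables by negations and binary
   conjunctions over disjoint sets of variables: arbitrary fan-in gates are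
   folded, starting from the constant true on the empty set of variables. *)
Section ReadOnceInduction.
Variables (n : nat) (P : seq 'I_n -> ({ffun 'I_n -> bool} -> bool) -> Prop).
Hypothesis P_eq : forall L f g, f =1 g -> P L f -> P L g.
Hypothesis P_var : forall i, P [:: i] (fun x => x i).
Hypothesis P_true : P [::] (fun=> true).
Hypothesis P_and : forall L1 L2 f1 f2, uniq (L1 ++ L2) -> P L1 f1 -> P L2 f2 ->
  P (L1 ++ L2) (fun x => f1 x && f2 x).
Hypothesis P_not : forall L f, (0 < size L)%nat -> P L f -> P L (fun x => ~~ f x).

Lemma read_once_ind (phi : formula n) : fwf phi -> uniq (fleaves phi) ->
  P (fleaves phi) (fun x => feval x phi).
Proof.
elim/formula_nested_ind: phi => [i|g IH|gs IH|gs IH] //=.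
- by move=> wg ug; apply: P_not; [exact: size_fleaves_gt0 | exact: IH].
- case/andP=> _; elim: gs IH => //= g gs IHgs [IHg /IHgs{}IHgs] /andP[wg wgs] u.
  have := u; rewrite cat_uniq => /and3P[ug _ ugs].
  by apply: P_and => //; [exact: IHg | exact: IHgs].
(* De Morgan: the disjunction is the negation of a conjunction of negations. Nonempty gates
   guarantee the leaf that [P_not] asks for. *)
- case/andP=> gs0 wgs ugs; have sz := @size_fleaves_gt0 _ (FOr gs).
  pose nall (x : {ffun 'I_n -> bool}) := all (fun g => ~~ feval x g) gs.
  apply: (@P_eq _ (fun x => ~~ nall x)).
    by move=> x; rewrite /nall -(has_predC _ gs); apply: eq_has => g /=; rewrite negbK.
  apply: P_not; first by apply: sz; rewrite /= gs0.
  rewrite /nall; elim: gs IH wgs ugs {gs0 sz nall} => //= g gs IHgs.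
  move=> [IHg /IHgs{}IHgs] /andP[wg wgs] u.
  have := u; rewrite cat_uniq => /and3P[ug _ ugs].
  apply: P_and => //; last exact: IHgs.
  by apply: P_not; [exact: size_fleaves_gt0 | exact: IHg].
Qed.

End ReadOnceInduction.

(** * Spectral sensitivity *)

Section SpectralSensitivity.
Variables (K : rcfType) (n : nat).
Implicit Types (x y : {ffun 'I_n -> bool}) (g h : {ffun 'I_n -> bool} -> K).

Definition flip (i : 'I_n) x : {ffun 'I_n -> bool} := [ffun j => x j (+) (j == i)].

Lemma flipK i : involutive (flip i).
Proof. by move=> x; apply/ffunP=> j; rewrite !ffunE addbK. Qed.

(** The uniform expectation: with this normalization, functions of disjoint sets of variables are
    independent and their means multiply. *)
Definition mean g : K := #|{ffun 'I_n -> bool}|%:R^-1 * \sum_x g x.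

Lemma card_cube_gt0 : 0 < #|{ffun 'I_n -> bool}|%:R :> K.
Proof. by rewrite ltr0n; apply/card_gt0P; exists [ffun=> false]. Qed.

Lemma eq_mean g h : g =1 h -> mean g = mean h.
Proof. by move=> gh; congr (_ * _); apply: eq_bigr. Qed.

Lemma meanD g h : mean (fun x => g x + h x) = mean g + mean h.
Proof. by rewrite /mean big_split /= mulrDr. Qed.

Lemma meanZ c g : mean (fun x => c * g x) = c * mean g.
Proof. by rewrite /mean -mulr_sumr mulrCA. Qed.

Lemma mean1 : mean (fun=> 1) = 1.
Proof. by rewrite /mean sumr_const mulVf // gt_eqF ?card_cube_gt0. Qed.

Lemma mean0 : mean (fun=> 0) = 0.
Proof. by rewrite /mean big1 ?mulr0. Qed.

Lemma mean_flip i g : mean (fun x => g (flip i x)) = mean g.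
Proof. by rewrite /mean [in RHS](reindex_inj (inv_inj (flipK i))). Qed.

Definition depends_on (L : seq 'I_n) g := forall x y, {in L, x =1 y} -> g x = g y.

Lemma depends_flip (L : seq 'I_n) g i x :
  depends_on L g -> i \notin L -> g (flip i x) = g x.
Proof.
move=> gL iL; apply: gL => j jL; rewrite ffunE.
by case: eqP jL iL => [->|_] jL; rewrite ?jL // addbF.
Qed.

Lemma depends_on_flip (L : seq 'I_n) g i :
  depends_on L g -> depends_on L (fun x => g (flip i x)).
Proof. by move=> gL x y xy; apply: gL => j jL; rewrite !ffunE xy. Qed.

Lemma depends_onM (L1 L2 : seq 'I_n) g h : depends_on L1 g -> depends_on L2 h ->
  depends_on (L1 ++ L2) (fun x => g x * h x).
Proof.
move=> g1 h2 x y xy.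
by rewrite (g1 x y) ?(h2 x y) // => j jL; apply: xy; rewrite mem_cat jL ?orbT.
Qed.

(* Exchanging the coordinates outside [L1] between two independent points is a
   measure preserving involution of the square of the cube. *)
Lemma meanM (L1 L2 : seq 'I_n) g h : uniq (L1 ++ L2) ->
  depends_on L1 g -> depends_on L2 h -> mean (fun x => g x * h x) = mean g * mean h.
Proof.
rewrite cat_uniq => /and3P[_ /hasPn dis _] gL hL.
pose mix x y : {ffun 'I_n -> bool} := [ffun j => if j \in L1 then x j else y j].
pose swap p := (mix p.1 p.2, mix p.2 p.1).
have swapK : involutive swap.
  by move=> [x y]; congr pair; apply/ffunP=> j; rewrite !ffunE /=; case: (j \in L1).
have N0 : #|{ffun 'I_n -> bool}|%:R != 0 :> K by rewrite gt_eqF ?card_cube_gt0.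
have -> : mean g * mean h = #|{ffun 'I_n -> bool}|%:R^-1 *
    (#|{ffun 'I_n -> bool}|%:R^-1 * \sum_p g p.1 * h p.2).
  rewrite /mean -(pair_bigA _ (fun x y => g x * h y)) /= mulrACA -mulrA.
  by rewrite mulr_suml; do 2 congr (_ * _); apply: eq_bigr => x _; rewrite mulr_sumr.
rewrite (reindex_inj (inv_inj swapK)) /=.
congr (_ * _).
rewrite (eq_bigr (fun p => g p.1 * h p.1)) => [|[x y] _ /=]; last first.
  congr (_ * _); first by apply: gL => j jL; rewrite ffunE jL.
  by apply: hL => j jL; rewrite ffunE (negbTE (dis j jL)).
rewrite -(pair_bigA _ (fun x y => g x * h x)) /= mulr_sumr.
by apply: eq_bigr => x _; rewrite sumr_const -[X in _ = _ * X]mulr_natl mulKf.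
Qed.

(** [A] lives on the zeros of [f], [B] on the ones. The norms are [sqrt (size L)] and 1, so the edge
    sum equals [sqrt (size L)] times their product. This asymmetric scaling makes conjunction
    additive without square roots, and allows [A = 0] for the constant true. *)
Definition sensitivity_witness (L : seq 'I_n) (f : {ffun 'I_n -> bool} -> bool) (A B : {ffun 'I_n -> bool} -> K) :=
  [/\ depends_on L A /\ depends_on L B,
      forall x, 0 <= A x /\ 0 <= B x,
      forall x, (f x -> A x = 0) /\ (~~ f x -> B x = 0),
      mean (fun x => A x * A x) = (size L)%:R /\ mean (fun x => B x * B x) = 1 &
      \sum_(i <- L) mean (fun x => A x * B (flip i x)) = (size L)%:R].

Lemma mean_half i : mean (fun x => 2%:R * (x i)%:R) = 1.
Proof.
have h1 : mean (fun x => (x i)%:R + (flip i x i)%:R) = 1.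
  rewrite -[RHS]mean1; apply: eq_mean => x.
  by rewrite ffunE eqxx addbT; case: (x i); rewrite ?addr0 ?add0r.
by rewrite meanZ -[RHS]h1 meanD (mean_flip i (fun x => (x i)%:R)) mulr_natl mulr2n.
Qed.

Lemma sensitivity_var i : exists A B, sensitivity_witness [:: i] (fun x => x i) A B.
Proof.
have s2 : Num.sqrt 2%:R * Num.sqrt 2%:R = 2%:R :> K by rewrite -expr2 sqr_sqrtr ?ler0n.
have sq (b : bool) : Num.sqrt 2%:R * b%:R * (Num.sqrt 2%:R * b%:R) = 2%:R * b%:R :> K.
  by rewrite mulrACA s2; case: b; rewrite ?mulr1 ?mulr0.
have hn : mean (fun x => 2%:R * (~~ x i)%:R) = 1.
  rewrite -[RHS](mean_half i) -[RHS](mean_flip i).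
  by apply: eq_mean => x; rewrite ffunE eqxx addbT.
exists (fun x => Num.sqrt 2%:R * (~~ x i)%:R), (fun x => Num.sqrt 2%:R * (x i)%:R).
split.
- by split=> x y xy; rewrite xy ?inE.
- by move=> x; rewrite !mulr_ge0 ?sqrtr_ge0 ?ler0n.
- by move=> x; split=> [->|/negbTE->]; rewrite mulr0.
- by split; [apply: etrans hn | apply: etrans (mean_half i)]; apply: eq_mean => x; rewrite sq.
- rewrite big_seq1; apply: etrans hn; apply: eq_mean => x.
  by rewrite ffunE eqxx addbT sq.
Qed.

Lemma sensitivity_true : exists A B, sensitivity_witness [::] (fun=> true) A B.
Proof.
exists (fun=> 0), (fun=> 1); split=> //.
- split; last by rewrite -[RHS]mean1; apply: eq_mean => x; rewrite mulr1.
  by rewrite -[RHS]mean0; apply: eq_mean => x; rewrite mulr0.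
- by rewrite big_nil.
Qed.

(** The zero-side vector uses only inputs where exactly one conjunct fails: [A1 B2 + B1 A2], against
    [B1 B2]. Its two terms have disjoint supports, so squared norms add. Flipping a variable of one
    conjunct leaves the other conjunct's factor fixed, so in the edge sum one term gives that
    conjunct's own sum and the other vanishes. *)
Lemma sensitivity_and (L1 L2 : seq 'I_n) (f1 f2 : {ffun 'I_n -> bool} -> bool) :
  uniq (L1 ++ L2) ->
  (exists A B, sensitivity_witness L1 f1 A B) ->
  (exists A B, sensitivity_witness L2 f2 A B) ->
  exists A B, sensitivity_witness (L1 ++ L2) (fun x => f1 x && f2 x) A B.
Proof.
move=> u [A1 [B1 [[dA1 dB1] ge1 z1 [nA1 nB1] c1]]] [A2 [B2 [[dA2 dB2] ge2 z2 [nA2 nB2] c2]]].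
have AB1 x : A1 x * B1 x = 0.
  by have [fA fB] := z1 x; case: (boolP (f1 x)) => [/fA->|/fB->]; rewrite ?mul0r ?mulr0.
have AB2 x : A2 x * B2 x = 0.
  by have [fA fB] := z2 x; case: (boolP (f2 x)) => [/fA->|/fB->]; rewrite ?mul0r ?mulr0.
have sq (L : seq 'I_n) g h : depends_on L g -> depends_on L h -> depends_on L (fun x => g x * h x).
  by move=> dg dh x y xy; rewrite (dg _ _ xy) (dh _ _ xy).
exists (fun x => A1 x * B2 x + B1 x * A2 x), (fun x => B1 x * B2 x); split.
- split; last exact: depends_onM.
  by move=> x y xy; rewrite (depends_onM dA1 dB2 xy) (depends_onM dB1 dA2 xy).
- by move=> x; have [a1 b1] := ge1 x; have [a2 b2] := ge2 x; rewrite addr_ge0 ?mulr_ge0.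
- move=> x; have [fA1 fB1] := z1 x; have [fA2 fB2] := z2 x; split.
    by case/andP=> /fA1-> /fA2->; rewrite mul0r mulr0 addr0.
  by rewrite negb_and => /orP[/fB1->|/fB2->]; rewrite ?mul0r ?mulr0.
- split; last first.
    rewrite -[RHS]mulr1 -{1}nB1 -nB2 -(meanM u); try exact: sq.
    by apply: eq_mean => x; rewrite mulrACA.
  rewrite size_cat natrD -nA1 -nA2 -[X in X + _]mulr1 -[X in _ + X]mul1r -{1}nB2 -nB1.
  rewrite -!(meanM u) -?meanD; try exact: sq.
  by apply: eq_mean => x; have : A1 x * B1 x * (A2 x * B2 x) = 0; [rewrite AB1 mul0r | lra].
- rewrite big_cat size_cat natrD -c1 -c2 /=.
  have disj := u; rewrite cat_uniq in disj; case/and3P: disj => _ /hasPn dis _.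
  congr (_ + _); rewrite 2!big_seq; apply: eq_bigr => i iL.
    have iL2 : i \notin L2 by apply/negP=> /dis; rewrite iL.
    rewrite -[RHS]mulr1 -nB2 -(meanM u); [|apply: sq => //; exact: depends_on_flip|exact: sq].
    by apply: eq_mean => x; rewrite (depends_flip _ dB2 iL2);
      have : B1 x * B1 (flip i x) * (A2 x * B2 x) = 0; [rewrite AB2 mulr0 | lra].
  have iL1 : i \notin L1 by apply: dis.
  rewrite -[RHS]mul1r -nB1 -(meanM u); [|exact: sq|apply: sq => //; exact: depends_on_flip].
  by apply: eq_mean => x; rewrite (depends_flip _ dB1 iL1);
    have : B2 x * B2 (flip i x) * (A1 x * B1 x) = 0; [rewrite AB1 mulr0 | lra].
Qed.

(** Swap the two vectors and rescale them by inverse factors: the edge sum, symmetric under flips,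
    is unchanged, and the factor [sqrt m] restores the asymmetric norms. *)
Lemma sensitivity_not (L : seq 'I_n) (f : {ffun 'I_n -> bool} -> bool) : (0 < size L)%nat ->
  (exists A B, sensitivity_witness L f A B) ->
  exists A B, sensitivity_witness L (fun x => ~~ f x) A B.
Proof.
move=> L0 [A [B [[dA dB] ge z [nA nB] c]]].
set m : K := (size L)%:R in nA c *; have m0 : 0 < m by rewrite ltr0n.
have s0 : 0 < Num.sqrt m by rewrite sqrtr_gt0.
have ss : Num.sqrt m * Num.sqrt m = m by rewrite -expr2 sqr_sqrtr ?ltW.
have sN : Num.sqrt m != 0 by rewrite gt_eqF.
have ssV : (Num.sqrt m)^-1 * (Num.sqrt m)^-1 = m^-1 by rewrite -invfM ss.
exists (fun x => Num.sqrt m * B x), (fun x => (Num.sqrt m)^-1 * A x); split.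
- by split=> x y xy; rewrite ?(dA _ _ xy) ?(dB _ _ xy).
- by move=> x; have [a b] := ge x; rewrite !mulr_ge0 ?invr_ge0 ?(ltW s0).
- by move=> x; have [fA fB] := z x; split=> [/fB->|/negbNE/fA->]; rewrite mulr0.
- split.
    rewrite -[RHS]mulr1 -[X in _ = _ * X]nB -meanZ -/m.
    by apply: eq_mean => x; rewrite mulrACA ss.
  rewrite -[RHS](mulVf (lt0r_neq0 m0)) -[X in _ = _ * X]nA -meanZ.
  by apply: eq_mean => x; rewrite mulrACA ssV.
- rewrite -/m -[RHS]c; apply: eq_bigr => i _; rewrite -[RHS](mean_flip i).
  by apply: eq_mean => x; rewrite flipK mulrACA divff // mul1r mulrC.
Qed.

Lemma sensitivity_read_once (phi : formula n) : fwf phi -> uniq (fleaves phi) ->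
  exists A B, sensitivity_witness (fleaves phi) (fun x => feval x phi) A B.
Proof.
apply: (@read_once_ind n (fun L f => exists A B, sensitivity_witness L f A B)).
- move=> L f g fg [A [B [d ge z nAB c]]]; exists A, B; split=> // x.
  by rewrite -fg.
- exact: sensitivity_var.
- exact: sensitivity_true.
- exact: sensitivity_and.
- exact: sensitivity_not.
Qed.

End SpectralSensitivity.

(** * Trigonometric polynomials and Bernstein's inequality *)

Section CirclePolynomials.
Variable K : rcfType.
Implicit Types (P U W : {poly K}) (g h : K -> K -> K).

(* On the unit circle, a trigonometric polynomial of degree [d] reads
   [P(cos t) + sin t * U(cos t)], and its derivative at [t = 0] is [U(1)]. *)
Definition circle_poly d g v := exists P U,
  [/\ (size P <= d.+1)%nat, (size U <= d)%nat,
      forall c s, c ^+ 2 + s ^+ 2 = 1 -> g c s = P.[c] + s * U.[c] & U.[1] = v].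

Lemma circle_poly_ext d g h v : (forall c s, c ^+ 2 + s ^+ 2 = 1 -> g c s = h c s) ->
  circle_poly d g v -> circle_poly d h v.
Proof.
by move=> gh [P [U [sP sU gE Uv]]]; exists P, U; split=> // c s cs; rewrite -gh ?gE.
Qed.

Lemma circle_poly_le d d' g v : (d <= d')%nat -> circle_poly d g v -> circle_poly d' g v.
Proof.
by move=> dd' [P [U [sP sU gE Uv]]]; exists P, U; split=> //; [apply: leq_trans sP _ | apply: leq_trans sU _].
Qed.

Lemma circle_poly_cst a : circle_poly 0 (fun _ _ => a) 0.
Proof.
exists a%:P, 0; split=> [||c s _|]; rewrite ?size_poly0 ?size_polyC ?leq_b1 //.
  by rewrite hornerC horner0 mulr0 addr0.
by rewrite horner0.
Qed.

Lemma circle_poly_cos : circle_poly 1 (fun c _ => c) 0.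
Proof.
exists 'X, 0; split=> [||c s _|]; rewrite ?size_polyX ?size_poly0 //.
  by rewrite hornerX horner0 mulr0 addr0.
by rewrite horner0.
Qed.

Lemma circle_poly_sin : circle_poly 1 (fun _ s => s) 1.
Proof.
exists 0, 1; split=> [||c s _|]; rewrite ?size_poly1 ?size_poly0 //.
  by rewrite !hornerE.
by rewrite hornerE.
Qed.

Lemma circle_polyD d g h v w : circle_poly d g v -> circle_poly d h w ->
  circle_poly d (fun c s => g c s + h c s) (v + w).
Proof.
move=> [P [U [sP sU gE Uv]]] [Q [W [sQ sW hE Ww]]]; exists (P + Q), (U + W); split.
- by rewrite (leq_trans (size_polyD _ _)) // geq_max sP.
- by rewrite (leq_trans (size_polyD _ _)) // geq_max sU.
- by move=> c s cs; rewrite gE // hE // !hornerD mulrDr addrACA.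
- by rewrite hornerD Uv Ww.
Qed.

(** The product of the two sine parts is brought back to normal form by [s ^+ 2 = 1 - c ^+ 2]; the
    new slope is Leibniz's rule at [t = 0], the point [(1, 0)]. *)
Lemma circle_polyM d e g h v w : circle_poly d g v -> circle_poly e h w ->
  circle_poly (d + e) (fun c s => g c s * h c s) (g 1 0 * w + v * h 1 0).
Proof.
move=> [P [U [sP sU gE Uv]]] [Q [W [sQ sW hE Ww]]].
exists (P * Q + (1%:P - 'X^2) * (U * W)), (P * W + U * Q); split.
- rewrite (leq_trans (size_polyD _ _)) // geq_max; apply/andP; split.
    by apply: leq_trans (size_polyMleq _ _) _; lia.
  have [-> | U0] := eqVneq U 0; first by rewrite mul0r mulr0 size_poly0.
  have [-> | W0] := eqVneq W 0; first by rewrite !mulr0 size_poly0.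
  have s2 : leq (size (1%:P - 'X^2 : {poly K})) 3.
    by rewrite (leq_trans (size_polyD _ _)) // size_polyN size_polyXn size_poly1.
  move: U0 W0; rewrite -!size_poly_gt0 => U0 W0.
  apply: leq_trans (size_polyMleq _ _) _.
  by have := size_polyMleq U W; lia.
- rewrite (leq_trans (size_polyD _ _)) // geq_max; apply/andP; split.
    have [-> | W0] := eqVneq W 0; first by rewrite mulr0 size_poly0.
    by move: W0; rewrite -size_poly_gt0 => W0; apply: leq_trans (size_polyMleq _ _) _; lia.
  have [-> | U0] := eqVneq U 0; first by rewrite mul0r size_poly0.
  by move: U0; rewrite -size_poly_gt0 => U0; apply: leq_trans (size_polyMleq _ _) _; lia.
- move=> c s cs; rewrite gE // hE //.
  have -> : (P * Q + (1%:P - 'X^2) * (U * W)).[c] = P.[c] * Q.[c] + (1 - c * c) * (U.[c] * W.[c]).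
    by rewrite !(hornerD, hornerN, hornerM, hornerX, hornerC).
  have -> : (P * W + U * Q).[c] = P.[c] * W.[c] + U.[c] * Q.[c] by rewrite !(hornerD, hornerM).
  have s2 : s * s = 1 - c * c by rewrite -expr2 -cs expr2 addrAC subrr add0r.
  move: P.[c] U.[c] Q.[c] W.[c] => p u q r.
  by ring: s2.
- have e10 : 1 ^+ 2 + 0 ^+ 2 = 1 :> K by rewrite expr1n expr0n addr0.
  rewrite hornerD !hornerM Uv Ww gE // hE // !mul0r !addr0.
  by [].
Qed.

Lemma circle_poly_sum (I : eqType) (r : seq I) d (g : I -> K -> K -> K) v :
  (forall i, i \in r -> circle_poly d (g i) (v i)) ->
  circle_poly d (fun c s => \sum_(i <- r) g i c s) (\sum_(i <- r) v i).
Proof.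
elim: r => [_|i r IH gv].
  rewrite big_nil; apply: circle_poly_le (leq0n d) _.
  by apply: circle_poly_ext (circle_poly_cst 0) => c s _; rewrite big_nil.
have gr : circle_poly d (fun c s => \sum_(j <- r) g j c s) (\sum_(j <- r) v j).
  by apply: IH => j jr; apply: gv; rewrite inE jr orbT.
have gi := gv i (mem_head i r); rewrite big_cons.
by apply: circle_poly_ext (circle_polyD gi gr) => c s _; rewrite big_cons.
Qed.

Lemma circle_polyZ a d g v : circle_poly d g v -> circle_poly d (fun c s => a * g c s) (a * v).
Proof.
by move=> gv; have := circle_polyM (circle_poly_cst a) gv; rewrite mul0r addr0.
Qed.

Lemma circle_poly_prod (I : eqType) (r : seq I) (d : I -> nat) (g : I -> K -> K -> K) v :
  uniq r -> (forall i, circle_poly (d i) (g i) (v i)) ->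
  circle_poly (\sum_(i <- r) d i) (fun c s => \prod_(i <- r) g i c s)
    (\sum_(i <- r) v i * \prod_(j <- r | j != i) g j 1 0).
Proof.
move=> + gv; elim: r => [_|i r IH /= /andP[ir ur]].
  by rewrite !big_nil; apply: circle_poly_ext (circle_poly_cst 1) => c s _; rewrite big_nil.
rewrite !big_cons eqxx /=.
have := circle_polyM (gv i) (IH ur).
rewrite addrC mulr_sumr.
have -> : \prod_(j <- r | j != i) g j 1 0 = \prod_(j <- r) g j 1 0.
  rewrite [LHS]big_seq_cond [RHS]big_seq; apply: eq_bigl => j.
  by case: (boolP (j \in r)) => //= jr; apply: contraNneq ir => <-.
have -> : \sum_(j <- r) v j * \prod_(k <- i :: r | k != j) g k 1 0 =
          \sum_(j <- r) g i 1 0 * (v j * \prod_(k <- r | k != j) g k 1 0).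
  rewrite [LHS]big_seq [RHS]big_seq; apply: eq_bigr => j jr.
  have ij : i != j by apply: contraNneq ir => ->.
  by rewrite big_cons ij mulrCA.
by apply: circle_poly_ext => c s _; rewrite big_cons.
Qed.

(* de Moivre: on [(cos t, sin t)] these are [cos (k t)] and [sin (k t)]. *)
Fixpoint multiple_angle k (c s : K) : K * K :=
  if k is k'.+1 then
    let: (a, b) := multiple_angle k' c s in (a * c - b * s, b * c + a * s)
  else (1, 0).

Lemma multiple_angle0 k : multiple_angle k 1 0 = (1, 0).
Proof. by elim: k => //= k ->; congr pair; ring. Qed.

Lemma multiple_angleN k c s :
  multiple_angle k c (- s) = ((multiple_angle k c s).1, - (multiple_angle k c s).2).
Proof.
elim: k => [|k IH] /=; first by rewrite oppr0.
by rewrite IH; case: multiple_angle => a b /=; congr pair; ring.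
Qed.

Lemma circle_poly_multiple_angle k :
  circle_poly k (fun c s => (multiple_angle k c s).1) 0 /\
  circle_poly k (fun c s => (multiple_angle k c s).2) k%:R.
Proof.
elim: k => [|k [IHc IHs]]; first by split; apply: circle_poly_cst.
rewrite -addn1; split.
  have := circle_polyD (circle_polyM IHc circle_poly_cos)
    (circle_polyZ (-1) (circle_polyM IHs circle_poly_sin)).
  rewrite multiple_angle0 /= !(mulr0, mul0r, addr0).
  by apply: circle_poly_ext => c s _ /=; rewrite addn1 /=; case: multiple_angle => a b /=; ring.
have := circle_polyD (circle_polyM IHs circle_poly_cos) (circle_polyM IHc circle_poly_sin).
rewrite multiple_angle0 /= !(mulr0, mul0r, addr0, add0r) !mulr1 natrD.
by apply: circle_poly_ext => c s _ /=; rewrite addn1 /=; case: multiple_angle => a b /=; ring.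
Qed.

(** Each sign change gives a root by the intermediate value theorem; each new root lies to the left
    of [x k], hence of all the previous ones. *)
Lemma alternating_roots W (x : nat -> K) k :
  (forall j, (j < k)%nat -> x j.+1 < x j) ->
  (forall j, (j <= k)%nat -> 0 < (-1) ^+ j * W.[x j]) ->
  exists s : seq K, [/\ size s = k, uniq s, all (root W) s & all (fun r => x k < r < x 0%nat) s].
Proof.
elim: k => [|k IH] xd xs; first by exists [::].
have [s [ss us rs bs]] := IH (fun j jk => xd j (ltnW jk)) (fun j jk => xs j (leqW jk)).
have xk := xd k (leqnn _).
have [|r] := @poly_ivtoo K W (x k.+1) (x k) (ltW xk).
  have := mulr_gt0 (xs k (leqnSn _)) (xs k.+1 (leqnn _)).
  rewrite exprS mulN1r mulNr mulrN mulrACA -expr2 sqrr_sign mul1r oppr_gt0.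
  by rewrite mulrC.
rewrite in_itv /= => /andP[r1 r2] rr.
exists (r :: s); split=> /=; rewrite ?ss ?rr ?us ?andbT //.
  by apply/negP=> /(allP bs); rewrite (lt_gtF r2).
have x0k : x k <= x 0%nat.
  elim: (k) xd => // m IHm xd; apply: le_trans (ltW (xd m _)) (IHm _) => // j jm.
  by apply: xd; apply: leqW.
rewrite r1 (lt_le_trans r2 x0k); apply/allP=> z /(allP bs)/andP[z1 ->].
by rewrite (lt_trans xk z1).
Qed.

(** Here [sin t * S.[cos t]] stands for [sin (d t)], sampled at its [d] extrema [(x j, y j)] on the
    upper half circle. If [U.[1]] exceeded [d M], then [a S - U] with [a = U.[1] / d > M] would take
    the sign of [S] at each [x j], giving [d - 1] roots below 1, besides the root 1 forced by the
    choice of [a]: too many for its size. *)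
Lemma schur_comparison d (S U : {poly K}) (x y : nat -> K) M :
  (size S <= d)%nat -> (size U <= d)%nat -> S.[1] = d%:R ->
  (forall j, (j.+1 < d)%nat -> x j.+1 < x j) ->
  (forall j, (j < d)%nat -> 0 < y j /\ x j < 1) ->
  (forall j, (j < d)%nat -> y j * S.[x j] = (-1) ^+ j) ->
  (forall j, (j < d)%nat -> `|y j * U.[x j]| <= M) ->
  U.[1] <= d%:R * M.
Proof.
case: d => [|d] sS sU S1 xd yx yS yU.
  by move: sU; rewrite leqn0 size_poly_eq0 => /eqP->; rewrite horner0 mul0r.
rewrite leNgt; apply/negP=> U1.
have d0 : 0 < d.+1%:R :> K by rewrite ltr0n.
set a := U.[1] / d.+1%:R; have aM : M < a by rewrite ltr_pdivlMr // mulrC.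
have aU : a * d.+1%:R = U.[1] by rewrite divfK // gt_eqF.
have M0 : 0 <= M by apply: le_trans (yU 0%nat _).
pose W := a *: S - U.
have sg j : (j <= d)%nat -> 0 < (-1) ^+ j * W.[x j].
  move=> jd; have [y0 _] := yx j jd.
  rewrite -(pmulr_rgt0 _ y0) hornerD hornerN hornerZ.
  have -> : y j * ((-1) ^+ j * (a * S.[x j] - U.[x j])) =
            (-1) ^+ j * (y j * S.[x j]) * a - (-1) ^+ j * (y j * U.[x j]) by ring.
  rewrite yS // -expr2 sqrr_sign mul1r subr_gt0; apply: le_lt_trans aM.
  by apply: le_trans (ler_norm _) _; rewrite normrM normr_sign mul1r yU.
have [s [ss us rs bs]] := alternating_roots xd sg.
have W0 : W != 0.
  by apply: contraTneq (sg 0%nat _) => // ->; rewrite horner0 mulr0 ltxx.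
have := @max_poly_roots K W (1 :: s) W0.
rewrite /= us rs /root hornerD hornerN hornerZ S1 aU subrr eqxx /=.
have -> /= : 1 \notin s.
  apply/negP=> /(allP bs)/andP[_]; have [_ /ltW] := yx 0%nat (ltn0Sn _).
  by rewrite leNgt => /negbTE->.
rewrite ss => /(_ isT isT); apply/negP; rewrite -leqNgt.
by rewrite (leq_trans (size_polyD _ _)) // geq_max size_polyN sU (leq_trans (size_scale_leq _ _)).
Qed.

End CirclePolynomials.

Lemma cos2_sin2 (t : R) : cos t ^+ 2 + sin t ^+ 2 = 1.
Proof. by rewrite !expr2 addrC; exact: sin2_cos2. Qed.

Lemma multiple_angle_cos_sin k (t : R) :
  multiple_angle k (cos t) (sin t) = (cos (INR k * t), sin (INR k * t)).
Proof.
elim: k => [|k IH]; first by rewrite Rmult_0_l cos_0 sin_0.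
rewrite [LHS]/= IH S_INR Rmult_plus_distr_r Rmult_1_l cos_plus sin_plus.
by congr pair.
Qed.

Definition chebyshev_angle d j : R := (INR j.*2.+1 / INR d * (PI / 2))%R.

Lemma PI2_gt0 : 0 < (PI / 2)%R.
Proof. exact/RltP/PI2_RGT_0. Qed.

Lemma PI_double : PI = (PI / 2)%R + (PI / 2)%R.
Proof. exact: double_var. Qed.

Lemma chebyshev_angle_bounds d j : (j < d)%nat ->
  0 < chebyshev_angle d j /\ chebyshev_angle d j < PI.
Proof.
move=> jd; have d0 : 0 < d%:R :> R by rewrite ltr0n; lia.
have h0 := PI2_gt0; have PIh := PI_double; rewrite /chebyshev_angle.
set h := (PI / 2)%R in h0 PIh *; rewrite PIh.
rewrite RmultE RdivE !INRE -mulr2n -[h *+ 2]mulr_natl.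
split; first by rewrite mulr_gt0 // divr_gt0 // ltr0n.
by rewrite ltr_pM2r // ltr_pdivrMr // -natrM ltr_nat; lia.
Qed.

Lemma chebyshev_angle_lt d j : (0 < d)%nat -> chebyshev_angle d j < chebyshev_angle d j.+1.
Proof.
move=> d0; rewrite /chebyshev_angle !RmultE !RdivE !INRE ltr_pM2r ?PI2_gt0 //.
by rewrite ltr_pM2r ?invr_gt0 ?ltr0n // ltr_nat; lia.
Qed.

Lemma sin_chebyshev_angle d j : (0 < d)%nat -> sin (INR d * chebyshev_angle d j) = (-1) ^+ j.
Proof.
move=> d0; have dN : d%:R != 0 :> R by rewrite pnatr_eq0 -lt0n.
have -> : (INR d * chebyshev_angle d j)%R = (INR j.*2.+1 * (PI / 2))%R.
  rewrite /chebyshev_angle !RmultE !RdivE !INRE.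
  by rewrite mulrA [d%:R * _]mulrC divfK.
elim: j => [|j IH]; first by rewrite Rmult_1_l sin_PI2.
have -> : (INR j.+1.*2.+1 * (PI / 2))%R = (INR j.*2.+1 * (PI / 2) + PI)%R.
  have PIh := PI_double; set h := (PI / 2)%R in PIh *; rewrite PIh doubleS !S_INR !R1E.
  by rewrite !RmultE !RplusE; ring.
by rewrite neg_sin IH exprS mulN1r.
Qed.

(** Only the derivative at [t = 0] is needed, so it suffices to compare the odd part of [g] with
    [sin (d t)] at the extrema of the latter. *)
Lemma circle_poly_le_bernstein d (g : R -> R -> R) v M : circle_poly d g v ->
  (forall c s, c ^+ 2 + s ^+ 2 = 1 -> `|g c s| <= M) -> v <= d%:R * M.
Proof.
move=> [P [U [_ sU gE <-]]] gM.
have [_ [Q [S [_ sS SE S1]]]] := @circle_poly_multiple_angle R d.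
(* The odd part is half the difference of the values at [t] and [-t], so it inherits the bound. *)
have UM t : `|sin t * U.[cos t]| <= M.
  have c1 := cos2_sin2 t; have c2 : cos t ^+ 2 + (- sin t) ^+ 2 = 1 by rewrite sqrrN.
  have := gM _ _ c1; have := gM _ _ c2; rewrite gE // gE // !ler_norml.
  by move=> /andP[h1 h2] /andP[h3 h4]; apply/andP; split; lra.
have SE' t : sin t * S.[cos t] = sin (INR d * t).
  have c1 := cos2_sin2 t; have c2 : cos t ^+ 2 + (- sin t) ^+ 2 = 1 by rewrite sqrrN.
  have := SE _ _ c1; have := SE _ _ c2.
  by rewrite multiple_angleN multiple_angle_cos_sin /=; lra.
apply: (@schur_comparison R d S U (fun j => cos (chebyshev_angle d j))
         (fun j => sin (chebyshev_angle d j))) => // j jd.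
- have [t0 t1] := chebyshev_angle_bounds (ltnW jd).
  have [u0 u1] := chebyshev_angle_bounds jd.
  apply/RltP/cos_decreasing_1; apply/RleP || apply/RltP; rewrite ?ltW //.
  exact: chebyshev_angle_lt (leq_ltn_trans (leq0n _) jd).
- have [t0 t1] := chebyshev_angle_bounds jd; split.
    by apply/RltP/sin_gt_0; apply/RltP.
  rewrite -[X in _ < X]cos_0; apply/RltP/cos_decreasing_1; try exact/RltP.
  + exact/RleP.
  + exact/RleP/ltW/(lt_trans t0 t1).
  + exact/RleP/ltW.
  + exact/RleP/ltW.
- by rewrite SE' sin_chebyshev_angle // (leq_ltn_trans (leq0n _) jd).
Qed.

Lemma bernstein d (g : R -> R -> R) v M : circle_poly d g v ->
  (forall c s, c ^+ 2 + s ^+ 2 = 1 -> `|g c s| <= M) -> `|v| <= d%:R * M.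
Proof.
move=> gv gM; rewrite ler_norml (circle_poly_le_bernstein gv gM) andbT lerNl -mulN1r.
apply: circle_poly_le_bernstein (circle_polyZ (-1) gv) _ => c s cs.
by rewrite mulN1r normrN gM.
Qed.

(** * Rotating the cube *)

Section RotatedForm.
Variables (K : rcfType) (n : nat).
Local Notation cube := {ffun 'I_n -> bool}.
Implicit Types (x y : {ffun 'I_n -> bool}) (A B g : cube -> K) (m : 'X_{1.. n}).

(* The rotation by the half angle; [a = cos (t/2)], [b = sin (t/2)]. *)
Definition rot a b (u v : bool) : K :=
  if u == v then a else if v then b else - b.

Definition rotate a b A y : K := \sum_(x : cube) (\prod_i rot a b (x i) (y i)) * A x.

Definition rotated_form a b g A B : K := \sum_(y : cube) g y * (rotate a b A y * rotate a b B y).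

Definition monomial m x : K := \prod_i (x i)%:R ^+ m i.

(** One bit's diagonal operator [w ^+ k], conjugated by the rotation and written in the full angle.
    It is the identity for [k = 0] and otherwise a rank-one projection of trigonometric degree 1,
    whatever the exponent. *)
Definition rot_kernel k c s (u v : bool) : K :=
  if k is 0%nat then (u == v)%:R
  else if u != v then 2%:R^-1 * s
  else if u then 2%:R^-1 * (1 + c) else 2%:R^-1 * (1 - c).

Lemma sum_rot k a b (u v : bool) : a ^+ 2 + b ^+ 2 = 1 ->
  \sum_(w : bool) (w%:R ^+ k * (rot a b u w * rot a b v w)) =
  rot_kernel k (a ^+ 2 - b ^+ 2) (2%:R * a * b) u v.
Proof.
move=> ab; rewrite big_bool /rot /rot_kernel.
case: k => [|k]; rewrite ?expr0 ?expr1n ?expr0n /=.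
  by case: u v => [] [] //=; nra.
by case: u v => [] [] //=; lra.
Qed.

(** The rotation and the monomial are both products over the bits, so the sum over the cube factors
    bit by bit. *)
Lemma rotated_form_monomial m a b A B : a ^+ 2 + b ^+ 2 = 1 ->
  rotated_form a b (monomial m) A B =
  \sum_(x : cube) \sum_(x' : cube) (A x * B x') *
    \prod_i rot_kernel (m i) (a ^+ 2 - b ^+ 2) (2%:R * a * b) (x i) (x' i).
Proof.
move=> ab; rewrite /rotated_form.
transitivity (\sum_(y : cube) \sum_(x : cube) \sum_(x' : cube) (A x * B x') *
    \prod_i ((y i)%:R ^+ m i * (rot a b (x i) (y i) * rot a b (x' i) (y i)))).
  apply: eq_bigr => y _; rewrite /rotate mulr_suml mulr_sumr; apply: eq_bigr => x _.
  rewrite mulr_sumr mulr_sumr; apply: eq_bigr => x' _.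
  rewrite !big_split /= -/(monomial m y); ring.
rewrite exchange_big; apply: eq_bigr => x _ /=.
rewrite exchange_big; apply: eq_bigr => x' _ /=.
rewrite -mulr_sumr; congr (_ * _).
under [RHS]eq_bigr => i _ do rewrite -sum_rot //.
by rewrite bigA_distr_bigA.
Qed.

Lemma rot_kernel_prod0 c s x y : \prod_i rot_kernel 0 c s (x i) (y i) = (x == y)%:R.
Proof.
have [-> | /eqP xy] := eqVneq x y; first by rewrite big1 // => i _; rewrite /= eqxx.
have /existsP[i xyi] : [exists i, x i != y i].
  by apply: contra_notT xy => /existsPn xy; apply/ffunP=> i; apply/eqP/negbNE/xy.
by rewrite (bigD1 i) //= (negbTE xyi) mul0r.
Qed.

(** Orthogonality of the rotation, read off from the empty monomial, all of whose kernels are the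
    identity. *)
Lemma rotated_form1 a b A B : a ^+ 2 + b ^+ 2 = 1 ->
  rotated_form a b (fun=> 1) A B = \sum_(x : cube) A x * B x.
Proof.
move=> ab.
transitivity (rotated_form a b (monomial 0%MM) A B).
  apply: eq_bigr => y _; congr (_ * _); rewrite /monomial big1 // => i _.
  by rewrite mnm0E expr0.
rewrite rotated_form_monomial //; apply: eq_bigr => x _.
have E x' c s : \prod_i rot_kernel (0%MM i) c s (x i) (x' i) = (x == x')%:R.
  by rewrite -(rot_kernel_prod0 c s); apply: eq_bigr => i _; rewrite mnm0E.
rewrite (eq_bigr _ (fun x' _ => congr1 _ (E x' _ _))) (bigD1 x) //= eqxx mulr1.
by rewrite big1 ?addr0 // => x' /negbTE xx'; rewrite eq_sym xx' mulr0.
Qed.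

Lemma rotated_form_bound a b g A B : a ^+ 2 + b ^+ 2 = 1 -> (forall x, `|g x| <= 1) ->
  `|rotated_form a b g A B| <= 2%:R^-1 * (\sum_(x : cube) A x * A x + \sum_(x : cube) B x * B x).
Proof.
move=> ab g1; rewrite -!(rotated_form1 _ _ ab) /rotated_form -big_split mulr_sumr.
apply: le_trans (ler_norm_sum _ _ _) _; apply: ler_sum => y _.
set u := rotate _ _ A y; set v := rotate _ _ B y; rewrite /= !mul1r normrM.
apply: le_trans (ler_wpM2r _ (g1 y)) _; rewrite ?normr_ge0 // mul1r ler_norml.
by have := sqr_ge0 (u - v); have := sqr_ge0 (u + v); lra.
Qed.

(** Bernstein's inequality asks for a bound at every point of the circle, while the rotations are
    parametrized by half angles. The point [c = -1] is separate because there the cosine [a] of the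
    half angle vanishes. *)
Lemma half_angle (c s : K) : c ^+ 2 + s ^+ 2 = 1 ->
  exists a b, [/\ a ^+ 2 + b ^+ 2 = 1, c = a ^+ 2 - b ^+ 2 & s = 2%:R * a * b].
Proof.
move=> cs; have [c1|c1] := eqVneq c (-1).
  have s0 : s = 0.
    by apply/eqP; rewrite -sqrf_eq0; apply/eqP; move: cs; rewrite c1; lra.
  by exists 0, 1; rewrite c1 s0; split; ring.
have c0 : 0 < 1 + c.
  have cN1 : -1 <= c by rewrite leNgt; apply/negP => cN; have := sqr_ge0 s; nra.
  by move: cN1; rewrite le_eqVlt eq_sym (negbTE c1) /=; lra.
have a2 : Num.sqrt ((1 + c) / 2%:R) ^+ 2 = (1 + c) / 2%:R.
  by rewrite sqr_sqrtr // divr_ge0 ?ler0n // ltW.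
have a0 : Num.sqrt ((1 + c) / 2%:R) != 0 by rewrite gt_eqF // sqrtr_gt0 divr_gt0 ?ltr0n.
set a := Num.sqrt _ in a0 a2; exists a, (s / (2%:R * a)).
have b2 : (s / (2%:R * a)) ^+ 2 = (1 - c) / 2%:R.
  rewrite expr_div_n exprMn a2 (_ : s ^+ 2 = (1 - c) * (1 + c)); last by lra.
  by field; rewrite gt_eqF.
by rewrite a2 b2; split; [field | field | field].
Qed.

End RotatedForm.

(** * The derivative of the rotated form at angle zero *)

Section DerivativeAtZero.
Variables (K : rcfType) (n : nat).
Local Notation cube := {ffun 'I_n -> bool}.
Implicit Types (x y : cube) (A B : cube -> K) (m : 'X_{1.. n}).

Definition kernel_slope k (u v : bool) : K := ((k != 0%nat) && (u != v))%:R * 2%:R^-1.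

Lemma circle_poly_kernel k (u v : bool) :
  circle_poly (k != 0%nat) (fun c s : K => rot_kernel k c s u v) (kernel_slope k u v).
Proof.
have lin p q r : circle_poly 1 (fun c s : K => 2%:R^-1 * (p + q * c + r * s)) (2%:R^-1 * r).
  have := circle_polyD (circle_polyD (circle_poly_le (leq0n 1) (circle_poly_cst p))
    (circle_polyZ q (circle_poly_cos K))) (circle_polyZ r (circle_poly_sin K)).
  by rewrite mulr0 addr0 add0r mulr1 => /(circle_polyZ 2%:R^-1).
rewrite /rot_kernel /kernel_slope; case: k => [|k] /=.
  by rewrite mul0r; apply: circle_poly_cst.
case: eqP => _ /=; last first.
  by rewrite mul1r; have := lin 0 0 1; rewrite mulr1; apply: circle_poly_ext => c s _; ring.
case: u; rewrite mul0r.
  by have := lin 1 1 0; rewrite mulr0; apply: circle_poly_ext => c s _; ring.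
by have := lin 1 (-1) 0; rewrite mulr0; apply: circle_poly_ext => c s _; ring.
Qed.

Lemma rot_kernel10 k (u v : bool) : rot_kernel k (1 : K) 0 u v = (u == v)%:R * (u%:R) ^+ k.
Proof.
case: k => [|k]; first by rewrite expr0 mulr1.
rewrite /rot_kernel mulr0 subrr mulr0; case: eqP => [->|] /=; last by rewrite mul0r.
rewrite mul1r; case: v; rewrite ?expr1n ?expr0n //.
by rewrite -(natrD _ 1 1) mulVf // pnatr_eq0.
Qed.

Lemma monomial_edge m i x : monomial K m (flip i x) - monomial K m x =
  ((~~ x i)%:R ^+ m i - (x i)%:R ^+ m i) * \prod_(j | j != i) (x j)%:R ^+ m j.
Proof.
rewrite /monomial (bigD1 i) //= [X in _ - X](bigD1 i) //= ffunE eqxx addbT mulrBl.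
congr (_ * _ - _); apply: eq_bigr => j /negbTE ji.
by rewrite ffunE ji addbF.
Qed.

(** At angle zero the undifferentiated kernels are diagonal, and the slope at [i] is zero unless bit
    [i] changes; hence only the edge from [x] to [flip i x] survives. The sign [(-1) ^+ x i] orients
    the difference upwards. *)
Lemma kernel_slope_sum m x B :
  \sum_(y : cube) B y * (\sum_i kernel_slope (m i) (x i) (y i) *
      \prod_(j | j != i) rot_kernel (m j) 1 0 (x j) (y j)) =
  \sum_i B (flip i x) * (2%:R^-1 * ((-1) ^+ x i * (monomial K m (flip i x) - monomial K m x))).
Proof.
under eq_bigr => y _ do rewrite mulr_sumr.
rewrite exchange_big; apply: eq_bigr => i _ /=.
rewrite (bigD1 (flip i x)) //= [X in _ + X]big1 ?addr0 => [|y yx].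
  rewrite monomial_edge (eq_bigr (fun j => (x j)%:R ^+ m j)) => [|j /negbTE ji]; last first.
    by rewrite rot_kernel10 ffunE ji addbF eqxx mul1r.
  rewrite /kernel_slope ffunE eqxx addbT; congr (_ * _); set p := \prod_(_ | _) _.
  by case: (m i) (x i) => [|k] [] /=; rewrite ?expr0 ?expr1n ?expr0n ?expr1 /=; ring.
have [xyi | xyi] := eqVneq (x i) (y i).
  by rewrite /kernel_slope xyi eqxx andbF !mul0r mulr0.
have /existsP[j /andP[ji xyj]] : [exists j, (j != i) && (x j != y j)].
  apply: contraNT yx => /existsPn xy; apply/eqP/ffunP=> j; rewrite ffunE.
  have [-> | ji] := eqVneq j i; first by move: xyi; case: (x i) (y i) => [] [].
  by have := xy j; rewrite ji /= negbK addbF => /eqP.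
by rewrite (bigD1 j) //= rot_kernel10 (negbTE xyj) !mul0r !mulr0.
Qed.

(* The sign patterns turn the antisymmetric generator of the rotations into
   the adjacency matrix of the cube: their product over an edge [x, flip i x]
   is [+1] when the edge goes up and [-1] when it goes down. *)
Definition weight x : nat := (\sum_i x i)%nat.
Definition sign0 x : K := (-1) ^+ (weight x)./2.
Definition sign1 x : K := - (-1) ^+ uphalf (weight x).

Lemma sign_edge i x : sign0 x * sign1 (flip i x) = (-1) ^+ x i.
Proof.
have : (weight (flip i x) + x i = weight x + ~~ x i)%nat.
  rewrite /weight (bigD1 i) //= [in RHS](bigD1 i) //= ffunE eqxx addbT.
  rewrite (eq_bigr (fun j => nat_of_bool (x j))) => [|j /negbTE ji]; last first.
    by rewrite ffunE ji addbF.
  by set S := (\sum_(_ < _ | _) _)%nat; case: (x i); lia.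
rewrite /sign0 /sign1; case: (x i) => /= E.
  have -> : (weight x)./2 = uphalf (weight (flip i x)) by lia.
  by rewrite mulrN -expr2 sqrr_sign expr1.
have -> : uphalf (weight (flip i x)) = (weight x)./2.+1 by lia.
by rewrite exprS mulN1r opprK -expr2 sqrr_sign expr0.
Qed.

End DerivativeAtZero.

(** * The lower bound on the approximate degree *)

Section ApproximateDegreeLowerBound.
Variable n : nat.
Local Notation cube := {ffun 'I_n -> bool}.
Implicit Types (x : cube) (q : {mpoly R[n]}).

Definition cube_val q x : R := q.@[fun i => (x i)%:R].

Lemma cube_valE q x : cube_val q x = \sum_(m <- msupp q) q@_m * monomial R m x.
Proof. exact: mevalE. Qed.

(** Bernstein's inequality for the rotated form of [q] between the sign-twisted [A] and [B]: the
    left side is its derivative at zero, and the last factor on the right bounds it on the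
    circle. *)
Lemma edge_difference_bound q (A B : cube -> R) :
  (forall x, `|cube_val q x| <= 1) ->
  2%:R^-1 * (\sum_(x : cube) \sum_i A x * B (flip i x) * (cube_val q (flip i x) - cube_val q x)) <=
  (mdegree q)%:R * (2%:R^-1 * (\sum_(x : cube) A x * A x + \sum_(x : cube) B x * B x)).
Proof.
move=> q1; pose A' x : R := sign0 R x * A x; pose B' x : R := sign1 R x * B x.
pose G c s := \sum_(m <- msupp q) q@_m * \sum_(x : cube) A' x *
  \sum_(y : cube) B' y * \prod_i rot_kernel (m i) c s (x i) (y i).
set v := (X in X <= _).
have Gv : circle_poly (mdegree q) G v.
  have -> : v = \sum_(m <- msupp q) q@_m * \sum_(x : cube) A' x *
      \sum_(y : cube) B' y * (\sum_i kernel_slope R (m i) (x i) (y i) *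
        \prod_(j | j != i) rot_kernel (m j) 1 0 (x j) (y j)).
    transitivity (\sum_(m <- msupp q) \sum_(x : cube) \sum_i q@_m * (A' x * (B' (flip i x) *
        (2%:R^-1 * ((-1) ^+ x i * (monomial R m (flip i x) - monomial R m x)))))); last first.
      apply: eq_bigr => m _; rewrite mulr_sumr; apply: eq_bigr => x _.
      by rewrite kernel_slope_sum mulr_sumr mulr_sumr.
    rewrite [RHS]exchange_big /v mulr_sumr; apply: eq_bigr => x _ /=.
    rewrite [RHS]exchange_big mulr_sumr; apply: eq_bigr => i _ /=.
    rewrite !cube_valE -sumrB !mulr_sumr; apply: eq_bigr => m _.
    rewrite /A' /B'; have := sign_edge R i x.
    have := sqrr_sign R (x i); set e : R := (-1) ^+ x i; set s0 := sign0 R x.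
    set s1 := sign1 R _ => e2 se; rewrite -mulrBr.
    transitivity (q@_m * (2%:R^-1 * (A x * B (flip i x) * (e ^+ 2 *
      (monomial R m (flip i x) - monomial R m x))))); first by rewrite e2; ring.
    by rewrite expr2 -{1}se; ring.
  apply: circle_poly_sum => m mq; apply: circle_polyZ; apply: circle_poly_sum => x _.
  apply: circle_polyZ; apply: circle_poly_sum => y _; apply: circle_polyZ.
  (* Each variable present adds 1 to the trigonometric degree, at most its exponent, so a monomial
     contributes no more than its total degree. *)
  have := circle_poly_prod (index_enum_uniq _) (fun i => circle_poly_kernel R (m i) (x i) (y i)).
  apply: circle_poly_le; rewrite /mdegree.
  have := msize_mdeg_lt mq; rewrite mdegE => mq'.
  apply: leq_trans (_ : \sum_i m i <= _)%nat; last by rewrite -ltnS (ltn_predK mq').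
  by apply: leq_sum => i _; case: (m i).
have half (a : R) : `|2%:R^-1 * a| = 2%:R^-1 * `|a| by rewrite normrM ger0_norm // invr_ge0 ler0n.
apply: le_trans (ler_norm v) (bernstein Gv _) => c s cs.
have [a [b [ab -> ->]]] := half_angle cs.
have -> : G (a ^+ 2 - b ^+ 2) (2%:R * a * b) = rotated_form a b (cube_val q) A' B'.
  rewrite /rotated_form.
  under [RHS]eq_bigr => y _ do rewrite cube_valE mulr_suml.
  rewrite exchange_big; apply: eq_bigr => m _ /=.
  under [RHS]eq_bigr => y _ do rewrite -mulrA.
  rewrite -mulr_sumr -/(rotated_form a b (monomial R m) A' B') rotated_form_monomial //.
  congr (_ * _); apply: eq_bigr => x _; rewrite mulr_sumr.
  by apply: eq_bigr => y _; rewrite mulrA.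
have -> : \sum_(x : cube) A x * A x = \sum_(x : cube) A' x * A' x.
  by apply: eq_bigr => x _; rewrite /A' /sign0 mulrACA -[in RHS]expr2 sqrr_sign mul1r.
have -> : \sum_(x : cube) B x * B x = \sum_(x : cube) B' x * B' x.
  by apply: eq_bigr => x _; rewrite /B' /sign1 mulrACA mulrNN -[in RHS]expr2 sqrr_sign mul1r.
exact: rotated_form_bound.
Qed.

Lemma approx_degree_lower_bound (phi : formula n) q : (0 < n)%nat -> read_once phi ->
  approximates q (fun v => feval v phi) -> Num.sqrt n%:R <= 6%:R * (mdegree q)%:R :> R.
Proof.
move=> n0 /andP[wf pe] qphi.
have uniqL : uniq (fleaves phi) by rewrite (perm_uniq pe) enum_uniq.
have sizeL : size (fleaves phi) = n by rewrite (perm_size pe) size_enum_ord.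
have [A [B [_ ge z [nA nB] c]]] := sensitivity_read_once R wf uniqL.
rewrite (perm_big _ pe) big_enum sizeL /= in c nA.
have qx x : if feval x phi then 2%:R / 3%:R <= cube_val q x /\ cube_val q x <= 1
    else 0 <= cube_val q x /\ cube_val q x <= 1 / 3%:R by apply: qphi.
have q1 x : `|cube_val q x| <= 1.
  by have := qx x; case: ifP => _ [h1 h2]; rewrite ler_norml; apply/andP; split; lra.
have m0 : 0 < n%:R :> R by rewrite ltr0n.
set r := Num.sqrt _; have r0 : 0 < r by rewrite sqrtr_gt0.
have rr : r * r = n%:R by rewrite -expr2 sqr_sqrtr ?ltW.
have N0 := card_cube_gt0 R n; set N := #|_|%:R in N0.
have unmean (g : cube -> R) : \sum_x g x = N * mean g.
  by rewrite /mean mulVKf // gt_eqF.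
have rV : r^-1 * r = 1 by rewrite mulVf // gt_eqF.
have -> : r = N^-1 * (r^-1 * \sum_(x : cube) \sum_i A x * B (flip i x)).
  rewrite exchange_big /= (eq_bigr _ (fun i _ => unmean _)) -mulr_sumr c -rr.
  by rewrite mulrCA mulKf ?gt_eqF // mulrA rV mul1r.
(* Dividing [A] by [r = sqrt n] gives both vectors mean square 1. *)
have bound := edge_difference_bound (fun x => r^-1 * A x) B q1.
have nAB : \sum_(x : cube) r^-1 * A x * (r^-1 * A x) + \sum_(x : cube) B x * B x = 2%:R * N.
  rewrite (eq_bigr _ (fun x _ => mulrACA _ _ _ _)) -mulr_sumr !unmean nA nB -rr.
  rewrite mulr1 (_ : _ * (N * _) = (r^-1 * r) * (r^-1 * r) * N); last by ring.
  by rewrite rV; ring.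
rewrite nAB mulKf ?pnatr_eq0 // in bound.
rewrite mulrC ler_pdivrMr //; apply: le_trans (_ : 6%:R * ((mdegree q)%:R * N) <= _); last first.
  by rewrite mulrA.
apply: le_trans (ler_wpM2l _ bound); last exact: ler0n.
rewrite mulrA mulr_sumr mulr_sumr; apply: ler_sum => x _.
rewrite mulr_sumr mulr_sumr; apply: ler_sum => i _.
have [a0 _] := ge x; have [_ b0] := ge (flip i x).
have [za _] := z x; have [_ zb] := z (flip i x).
have qa := qx x; have qb := qx (flip i x).
(* The weight is zero except on edges going from a zero of [f] to a one, where [q] increases by at
   least [1/3]; the factor 6 pays for this gap and for the half in the derivative. *)
have [fx | fx] := boolP (feval x phi); first by rewrite za // mulr0 !mul0r !mulr0.
have [fy | fy] := boolP (feval (flip i x) phi); last by rewrite zb // !(mulr0, mul0r).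
rewrite (negbTE fx) fy in qa qb; case: qa qb => [_ qa] [qb _].
have rV0 : 0 <= r^-1 by rewrite invr_ge0 ltW.
have ab := mulr_ge0 rV0 (mulr_ge0 a0 b0).
rewrite (_ : 6%:R * 2%:R^-1 = 3%:R :> R); last by field.
nra.
Qed.

End ApproximateDegreeLowerBound.

(** * Adversary vectors and reflections *)

Section AdversaryVectors.
Variables (K : rcfType) (n : nat).
Local Notation cube := {ffun 'I_n -> bool}.
Implicit Types (x y : cube) (L : seq 'I_n) (f : cube -> bool).

(* Feasible solutions, of value at most [sqrt (size L)], of the dual of the
   adversary semidefinite program of [f]. *)
Definition adversary_vectors L f (v : cube -> 'I_n -> K) :=
  [/\ forall x, f x -> \sum_(i <- L) v x i ^+ 2 <= (size L)%:R,
      forall y, ~~ f y -> \sum_(i <- L) v y i ^+ 2 <= 1 &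
      forall x y, f x -> ~~ f y -> \sum_(i <- L | x i != y i) v x i * v y i = 1].

Lemma adversary_var i : exists v, adversary_vectors [:: i] (fun x => x i) v.
Proof.
exists (fun _ _ => 1); split=> [x _|y _|x y xi yi]; rewrite ?big_seq1 ?expr1n //.
by rewrite big_mkcond big_seq1 xi (negbTE yi) mulr1.
Qed.

Lemma adversary_true : exists v, adversary_vectors [::] (fun=> true) v.
Proof. by exists (fun _ _ => 0); split=> // x _; rewrite big_nil. Qed.

(** True inputs concatenate both solutions, so their costs add. A false input is charged to a single
    failing conjunct, the first one if both fail, so its cost stays at most 1 and only that conjunct
    contributes to the pairing. *)
Lemma adversary_and L1 L2 f1 f2 : uniq (L1 ++ L2) ->
  (exists v, adversary_vectors L1 f1 v) -> (exists v, adversary_vectors L2 f2 v) ->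
  exists v, adversary_vectors (L1 ++ L2) (fun x => f1 x && f2 x) v.
Proof.
rewrite cat_uniq => /and3P[_ /hasPn dis _] [v1 [t1 z1 p1]] [v2 [t2 z2 p2]].
exists (fun x i => if i \in L1 then (if f1 x && ~~ f2 x then 0 else v1 x i)
                   else if f1 x then v2 x i else 0).
have split_sum (P : pred 'I_n) (g1 g2 : 'I_n -> K) :
    \sum_(i <- L1 ++ L2 | P i) (if i \in L1 then g1 i else g2 i) =
    \sum_(i <- L1 | P i) g1 i + \sum_(i <- L2 | P i) g2 i.
  rewrite big_cat /=; congr (_ + _); rewrite [LHS]big_seq_cond [RHS]big_seq_cond.
    by apply: eq_bigr => i /andP[->].
  by apply: eq_bigr => i /andP[/dis/negbTE->].
split=> [x /andP[fx1 fx2]|y|x y /andP[fx1 fx2]].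
- under eq_bigr => i _ do rewrite fx1 fx2 /= (fun_if (fun r => r ^+ 2)).
  by rewrite split_sum size_cat natrD lerD ?t1 ?t2.
- under eq_bigr => i _ do rewrite (fun_if (fun r => r ^+ 2)).
  rewrite split_sum; have [fy1 /= fy2 | fy1 _] := boolP (f1 y).
    by rewrite fy2 [X in X + _]big1 ?add0r ?z2 // => i _; rewrite expr0n.
  by rewrite [X in _ + X]big1 ?addr0 ?z1 // => i _; rewrite expr0n.
- under [X in _ -> X = _]eq_bigr => i _.
    rewrite fx1 fx2 /= (_ : _ * _ = if i \in L1 then
      v1 x i * (if f1 y && ~~ f2 y then 0 else v1 y i) else v2 x i * (if f1 y then v2 y i else 0)).
      over.
    by case: ifP.
  rewrite split_sum; have [fy1 /= fy2 | fy1 _] := boolP (f1 y).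
    by rewrite fy2 [X in X + _]big1 ?add0r ?p2 // => i _; rewrite mulr0.
  by rewrite [X in _ + X]big1 ?addr0 ?p1 // => i _; rewrite mulr0.
Qed.

(** Inverse scalings on the two sides preserve the pairings and exchange the two cost bounds. *)
Lemma adversary_not L f : (0 < size L)%nat ->
  (exists v, adversary_vectors L f v) -> exists v, adversary_vectors L (fun x => ~~ f x) v.
Proof.
move=> L0 [v [t z p]]; set r : K := Num.sqrt (size L)%:R.
have r0 : 0 < r by rewrite sqrtr_gt0 ltr0n.
have rr : r ^+ 2 = (size L)%:R by rewrite sqr_sqrtr ?ler0n.
exists (fun x i => (if f x then r^-1 else r) * v x i); split=> [x fx|y fy|x y fx fy].
- rewrite (negbTE fx); under eq_bigr do rewrite exprMn.
  by rewrite -mulr_sumr rr ler_piMr ?ler0n ?z.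
- rewrite (negbNE fy); under eq_bigr do rewrite exprMn.
  rewrite -mulr_sumr exprVn rr mulrC ler_pdivrMr ?ltr0n // mul1r t //.
  exact: negbNE.
- rewrite (negbTE fx) (negbNE fy) -(p y x) ?(negbNE fy) //.
  apply: eq_big => [i|i _]; first by rewrite eq_sym.
  by rewrite mulrACA divff ?gt_eqF // mul1r mulrC.
Qed.

Lemma adversary_read_once (phi : formula n) : fwf phi -> uniq (fleaves phi) ->
  exists v, adversary_vectors (fleaves phi) (fun x => feval x phi) v.
Proof.
apply: (@read_once_ind n (fun L f => exists v, adversary_vectors L f v)).
- move=> L f g fg [v [t z p]]; exists v.
  split=> [x|y|x y]; first by rewrite -fg; apply: t.
    by rewrite -fg; apply: z.
  by rewrite -(fg x) -(fg y); apply: p.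
- exact: adversary_var.
- exact: adversary_true.
- exact: adversary_and.
- exact: adversary_not.
Qed.

End AdversaryVectors.

(** * Inner products and reflections negating a given family of vectors *)

Section Reflections.
Variables (K : realFieldType) (N : nat).
Implicit Types (u w t : 'cV[K]_N) (S : 'M[K]_N).

Definition dot u w : K := (u^T *m w) 0 0.

Lemma dotC u w : dot u w = dot w u.
Proof. by rewrite /dot -(trmxK (u^T *m w)) trmx_mul trmxK [LHS]mxE. Qed.

Lemma dotDr u w t : dot u (w + t) = dot u w + dot u t.
Proof. by rewrite /dot mulmxDr mxE. Qed.

Lemma dotZr a u w : dot u (a *: w) = a * dot u w.
Proof. by rewrite /dot -scalemxAr mxE. Qed.

Lemma dotDl u w t : dot (u + w) t = dot u t + dot w t.
Proof. by rewrite dotC dotDr !(dotC t). Qed.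

Lemma dotZl a u w : dot (a *: u) w = a * dot u w.
Proof. by rewrite dotC dotZr dotC. Qed.

Lemma dotNr u w : dot u (- w) = - dot u w.
Proof. by rewrite -scaleN1r dotZr mulN1r. Qed.

Lemma dotNl u w : dot (- u) w = - dot u w.
Proof. by rewrite dotC dotNr dotC. Qed.

Lemma dot_sumr (I : Type) (r : seq I) (g : I -> 'cV[K]_N) u :
  dot u (\sum_(i <- r) g i) = \sum_(i <- r) dot u (g i).
Proof. by rewrite /dot mulmx_sumr summxE. Qed.

Lemma dotE u w : dot u w = \sum_k u k 0 * w k 0.
Proof. by rewrite /dot mxE; apply: eq_bigr => k _; rewrite mxE. Qed.

Lemma dot_ge0 u : 0 <= dot u u.
Proof. by rewrite dotE sumr_ge0 // => k _; rewrite -expr2 sqr_ge0. Qed.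

Lemma dot_eq0 u : dot u u = 0 -> u = 0.
Proof.
rewrite dotE => /psumr_eq0P u0; apply/colP=> k; rewrite mxE.
by apply/eqP; rewrite -sqrf_eq0 expr2 u0 // => j _; rewrite -expr2 sqr_ge0.
Qed.

Lemma dot_mulmx S u w : dot (S *m u) w = dot u (S^T *m w).
Proof. by rewrite /dot trmx_mul mulmxA. Qed.

Lemma cauchy_schwarz u w : dot u w ^+ 2 <= dot u u * dot w w.
Proof.
have [u0 | u0] := eqVneq (dot u u) 0.
  by rewrite (dot_eq0 u0) /dot trmx0 !mul0mx mxE expr0n mul0r.
have := dot_ge0 (dot u u *: w - dot u w *: u).
rewrite !(dotDl, dotDr, dotNl, dotNr, dotZl, dotZr) (dotC w u) => h.
have up : 0 < dot u u by rewrite lt0r u0 dot_ge0.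
by rewrite -(ler_pM2l up); lra.
Qed.

(* The reflection that negates a vector [t] besides those already negated by
   [S] is [S] followed by the Householder reflection along the component of [t]
   fixed by [S]. *)
Lemma reflection_exists (ts : seq 'cV[K]_N) : exists S,
  [/\ S^T = S, S *m S = 1%:M, forall t, t \in ts -> S *m t = - t &
      forall w, (forall t, t \in ts -> dot t w = 0) -> S *m w = w].
Proof.
elim: ts => [|t ts [S [ST SS Sts Sw]]].
  by exists 1%:M; split; rewrite ?trmx1 ?mulmx1 // => w _; rewrite mul1mx.
have Sdot u w : dot (S *m u) (S *m w) = dot u w by rewrite dot_mulmx ST mulmxA SS mul1mx.
set u := 2%:R^-1 *: (t + S *m t).
have Su : S *m u = u by rewrite -scalemxAr mulmxDr mulmxA SS mul1mx addrC.
have perp s : s \in ts -> dot u s = 0.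
  by move=> /Sts Ss; have := Sdot u s; rewrite Su Ss dotNr; lra.
(* [u] is the component of [t] fixed by [S]; if it vanishes, [S] already negates [t]. *)
have [u0 | u0] := eqVneq (dot u u) 0.
  exists S; split=> // [s|w tw]; last by apply: Sw => s sts; rewrite tw // inE sts orbT.
  rewrite inE => /predU1P[->|/Sts //].
  apply/eqP; rewrite -addr_eq0 addrC; apply/eqP.
  have /eqP := dot_eq0 u0; rewrite scaler_eq0 invr_eq0 pnatr_eq0 /=.
  by move/eqP.
pose c := 2%:R / dot u u; exists (S - c *: (u *m u^T)).
have app w : (S - c *: (u *m u^T)) *m w = S *m w - (c * dot u w) *: u.
  rewrite mulmxBl -scalemxAl -mulmxA [u^T *m w]mx11_scalar -/(dot u w) mul_mx_scalar.
  by rewrite scalerA.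
have ut : dot u t = dot u u.
  rewrite {2}/u dotZr dotDr -[X in _ + X]Sdot Su.
  have -> : dot u (S *m (S *m t)) = dot u t by rewrite mulmxA SS mul1mx.
  by lra.
split=> [||s|w tw].
- by rewrite linearB linearZ /= trmx_mul trmxK ST.
- have uST : u^T *m S = u^T by rewrite -{2}Su trmx_mul ST.
  set P := u *m u^T; have SP : S *m P = P by rewrite mulmxA Su.
  have PS : P *m S = P by rewrite -mulmxA uST.
  have PP : P *m P = dot u u *: P.
    by rewrite mulmxA -(mulmxA u) [u^T *m u]mx11_scalar mul_mx_scalar -scalemxAl.
  rewrite mulmxBl !mulmxBr SS -!scalemxAl -!scalemxAr SP PS PP !scalerA.
  rewrite (_ : c * c * dot u u = c + c); last by rewrite /c; field.
  by rewrite scalerDl opprB addrK subrK.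
- rewrite inE app => /predU1P[->|sts]; last by rewrite perp // mulr0 scale0r subr0 Sts.
  rewrite ut divfK // scalerA divff ?pnatr_eq0 // scale1r.
  by rewrite opprD addrCA subrr addr0.
- rewrite app Sw => [|s sts]; last by rewrite tw // inE sts orbT.
  suff -> : dot u w = 0 by rewrite mulr0 scale0r subr0.
  have Sww : S *m w = w by apply: Sw => s sts; rewrite tw // inE sts orbT.
  by rewrite dotZl dotDl -{2}Sww Sdot tw ?inE ?eqxx // addr0 mulr0.
Qed.

End Reflections.

(** * The walk polynomial *)

Section Walk.
Variables (K : realFieldType) (N : nat) (U : 'M[K]_N) (psi : 'cV[K]_N).
Hypothesis U_isometry : forall u w, dot (U *m u) (U *m w) = dot u w.

Definition walk_state t : 'cV[K]_N := iter t (mulmx U) psi.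
Definition walk_sum T : 'cV[K]_N := \sum_(0 <= t < T) walk_state t.

(** All states are unit vectors, so their pairwise inner products are at most 1. This keeps the
    normalized polynomial below 1. *)
Lemma walk_sum_le T : dot psi psi = 1 -> dot (walk_sum T) (walk_sum T) <= T%:R ^+ 2.
Proof.
move=> psi1; have st t : dot (walk_state t) (walk_state t) = 1.
  by elim: t => //= t IH; rewrite U_isometry.
have fixed t : dot (walk_state t) (walk_sum T) <= T%:R.
  rewrite dot_sumr -[X in _ <= X%:R]subn0 -[X in _ <= X]mulr1 mulr_natl -sumr_const_nat.
  apply: ler_sum => t' _; have := dot_ge0 (walk_state t - walk_state t').
  by rewrite !(dotDl, dotDr, dotNl, dotNr) !st (dotC (walk_state t')); lra.
rewrite {1}/walk_sum dotC dot_sumr expr2 mulr_natl -[X in _ *+ X]subn0 -sumr_const_nat.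
by apply: ler_sum => t _; rewrite dotC.
Qed.

(** An isometry preserves the overlap with a vector it fixes, so every state contributes equally. *)
Lemma walk_sum_fixed T w : U *m w = w -> dot w (walk_sum T) = T%:R * dot w psi.
Proof.
move=> Uw; rewrite dot_sumr (eq_bigr (fun=> dot w psi)) => [|t _].
  by rewrite sumr_const_nat subn0 mulr_natl.
by elim: t => //= t IH; rewrite -{1}Uw U_isometry.
Qed.

(* The sum telescopes when the starting vector lies in the range of [1 - U]. *)
Lemma walk_sum_cobounded T w : psi = 2%:R^-1 *: (w - U *m w) ->
  dot (walk_sum T) (walk_sum T) <= dot w w.
Proof.
move=> psiE; pose Uw t := iter t (mulmx U) w.
have -> : walk_sum T = 2%:R^-1 *: (w - Uw T).
  rewrite /walk_sum -[w]/(Uw 0%nat) -opprB -(telescope_sumr Uw (leq0n T)).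
  rewrite -sumrN scaler_sumr; apply: eq_bigr => t _; rewrite opprB.
  elim: t => [|t IH]; first exact: psiE.
  by rewrite /= /walk_state /= -/(walk_state t) IH -scalemxAr mulmxBr.
have nU : dot (Uw T) (Uw T) = dot w w.
  by elim: T => //= t IH; rewrite U_isometry.
rewrite dotZl dotZr; have := dot_ge0 (w + Uw T).
by rewrite !(dotDl, dotDr, dotNl, dotNr) nU (dotC (Uw T)); lra.
Qed.

End Walk.

Section WalkPolynomial.
Variables (K : realFieldType) (n N : nat) (S : 'M[K]_N).
Variables (D : 'I_N -> {mpoly K[n]}) (psi : 'cV[K]_N).

Fixpoint walk_poly t : 'I_N -> {mpoly K[n]} :=
  if t is t'.+1 then fun k => D k * \sum_l (S k l)%:MP * walk_poly t' l
  else fun k => (psi k 0)%:MP.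

Definition walk_norm_poly T : {mpoly K[n]} :=
  \sum_k (\sum_(0 <= t < T) walk_poly t k) ^+ 2.

Lemma msizeM_leq (p q : {mpoly K[n]}) a b : (msize p <= a.+1)%nat -> (msize q <= b.+1)%nat ->
  (msize (p * q) <= (a + b).+1)%nat.
Proof.
have [-> | p0] := eqVneq p 0; first by rewrite mul0r msize0.
have [-> | q0] := eqVneq q 0; first by rewrite mulr0 msize0.
move=> pa qb; rewrite msizeM // -ltnS prednK ?addn_gt0 ?lt0n ?mmeasure_poly_eq0 ?p0 //.
by rewrite -addnS -addSn leq_add.
Qed.

Lemma msize_sum_leq (I : Type) (r : seq I) (g : I -> {mpoly K[n]}) a :
  (forall i, msize (g i) <= a)%nat -> (msize (\sum_(i <- r) g i) <= a)%nat.
Proof.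
move=> ga; elim: r => [|i r IH]; first by rewrite big_nil msize0.
by rewrite big_cons (leq_trans (msizeD_le _ _)) // geq_max ga.
Qed.

Lemma msize_walk_poly t k : (forall k, msize (D k) <= 2)%nat -> (msize (walk_poly t k) <= t.+1)%nat.
Proof.
move=> D2; elim: t k => [|t IH] k /=; first by rewrite msizeC leq_b1.
apply: (@msizeM_leq _ _ 1 t) => //; apply: msize_sum_leq => l.
by apply: (@msizeM_leq _ _ 0 t) => //; rewrite msizeC leq_b1.
Qed.

(** The starting state is constant, so [T.+1] states involve at most [T] queries; squaring doubles
    the degree. *)
Lemma msize_walk_norm_poly T : (forall k, msize (D k) <= 2)%nat ->
  (msize (walk_norm_poly T.+1) <= T.*2.+1)%nat.
Proof.
move=> D2; apply: msize_sum_leq => k; rewrite -addnn expr2.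
have st : (msize (\sum_(0 <= t < T.+1) walk_poly t k) <= T.+1)%nat.
  rewrite big_seq_cond big_nat_cond.
  elim/big_ind: _ => [|p q p1 q1|t]; first by rewrite msize0.
    by rewrite (leq_trans (msizeD_le _ _)) // geq_max p1.
  case/andP=> /andP[_ tT] _; exact: leq_trans (msize_walk_poly _ _ D2) tT.
exact: msizeM_leq.
Qed.

Lemma walk_norm_polyE T (x : 'I_n -> K) :
  (walk_norm_poly T).@[x] =
  dot (walk_sum (diag_mx (\row_k (D k).@[x]) *m S) psi T)
      (walk_sum (diag_mx (\row_k (D k).@[x]) *m S) psi T).
Proof.
set U := _ *m S.
have wE t k : (walk_poly t k).@[x] = walk_state U psi t k 0.
  elim: t k => [|t IH] k /=; first by rewrite mevalC.
  rewrite mevalM -mulmxA mul_diag_mx !mxE (raddf_sum (meval x)); congr (_ * _).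
  by apply: eq_bigr => l _; apply: etrans (mevalM _ _ _) _; rewrite mevalC IH.
rewrite dotE (raddf_sum (meval x)); apply: eq_bigr => k _.
have -> : walk_sum U psi T k 0 = (\sum_(0 <= t < T) walk_poly t k).@[x].
  by rewrite (raddf_sum (meval x)) summxE; apply: eq_bigr => t _; apply: esym (wE t k).
exact: mevalM.
Qed.

End WalkPolynomial.

(** * The upper bound on the approximate degree *)

Section ApproximateDegreeUpperBound.
Variables (K : rcfType) (n : nat).
Local Notation cube := {ffun 'I_n -> bool}.
Local Notation index := (unit + 'I_n * bool)%type.
Local Notation N := #|{: index}|.
Implicit Types (x y : cube) (g : index -> K).

Definition vec g : 'cV[K]_N := \col_k g (enum_val k).

Lemma vec_dot g h : dot (vec g) (vec h) = \sum_i g i * h i.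
Proof.
rewrite dotE (eq_bigr (fun k => g (enum_val k) * h (enum_val k))); last by move=> k _; rewrite !mxE.
by rewrite -(big_enum_val (A := predT) (fun i => g i * h i)).
Qed.

Lemma index_sum g : \sum_i g i = g (inl tt) + \sum_i (g (inr (i, true)) + g (inr (i, false))).
Proof.
rewrite big_sumType /=; congr (_ + _); first by rewrite (big_pred1 tt) // => -[].
rewrite (eq_bigr (fun p => g (inr (p.1, p.2)))) => [|[i b] _] //.
rewrite -(pair_bigA _ (fun i b => g (inr (i, b)))) /=.
by apply: eq_bigr => i _; rewrite big_bool.
Qed.

Definition start_vec : 'cV[K]_N := vec (fun i => if i is inl _ then 1 else 0).

(** Besides the starting coordinate, there is one coordinate for each variable [i] and bit [b]. Its
    sign is [+1] exactly when [b = x i], and is affine in the input. *)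
Definition query_poly (k : 'I_N) : {mpoly K[n]} :=
  match enum_val k with
  | inl _ => 1
  | inr (i, b) => (-1) ^+ b *: (1 - 2%:R *: 'X_i)
  end.

Definition query_sign x (i : index) : K := if i is inr (i, b) then (-1) ^+ (x i (+) b) else 1.

Lemma query_polyE x k : (query_poly k).@[fun i => (x i)%:R] = query_sign x (enum_val k).
Proof.
rewrite /query_poly /query_sign; case: (enum_val k) => [_|[i b]]; first exact: meval1.
rewrite mevalZ mevalB mevalZ mevalXU meval1 signr_addb mulrC; congr (_ * _).
by case: (x i) => /=; rewrite ?expr1 ?expr0; ring.
Qed.

Lemma msize_query_poly k : (msize (query_poly k) <= 2)%nat.
Proof.
rewrite /query_poly; case: (enum_val k) => [_|[i b]]; first by rewrite msize1.
apply: leq_trans (msizeZ_le _ _) _; apply: leq_trans (msizeD_le _ _) _.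
rewrite geq_max msize1 mmeasureN (leq_trans (msizeZ_le _ _)) //.
by rewrite msizeX mdeg1.
Qed.

Variables (f : cube -> bool) (v : cube -> 'I_n -> K) (alpha : K).
Hypothesis alpha0 : alpha != 0.
Hypothesis v_true : forall x, f x -> \sum_i v x i ^+ 2 <= n%:R.
Hypothesis v_false : forall y, ~~ f y -> \sum_i v y i ^+ 2 <= 1.
Hypothesis v_pair : forall x y, f x -> ~~ f y -> \sum_(i | x i != y i) v x i * v y i = 1.

(** Supported on coordinates with [b = x i], hence fixed by the query; [witness_false] uses
    [b != y i], so the query negates it off the starting coordinate. Their supports meet where
    [x i != y i], and there the pairing condition cancels the starting coordinate. [alpha] balances
    the norms. *)
Definition witness_true x : 'cV[K]_N :=
  vec (fun k => if k is inr (i, b) then (b == x i)%:R * (alpha * v x i) else 1).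

Definition witness_false y : 'cV[K]_N :=
  vec (fun k => if k is inr (i, b) then (b != y i)%:R * - (alpha^-1 * v y i) else 1).

Lemma witness_orthogonal x y : f x -> ~~ f y -> dot (witness_false y) (witness_true x) = 0.
Proof.
move=> fx fy; rewrite vec_dot index_sum mulr1; apply/eqP; rewrite addr_eq0; apply/eqP.
rewrite -[LHS](v_pair fx fy) [in LHS]big_mkcond -sumrN; apply: eq_bigr => i _ /=.
by case: (x i) (y i) => [] [] /=; field.
Qed.

Lemma witness_true_norm x : f x -> dot (witness_true x) (witness_true x) <= 1 + alpha ^+ 2 * n%:R.
Proof.
move=> fx; rewrite vec_dot index_sum mulr1 lerD2l.
apply: le_trans (ler_wpM2l (sqr_ge0 alpha) (v_true fx)); rewrite mulr_sumr.
by apply: ler_sum => i _; case: (x i) => /=; rewrite le_eqVlt; apply/orP; left; apply/eqP; ring.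
Qed.

Lemma witness_false_norm y : ~~ f y -> dot (witness_false y) (witness_false y) <= 1 + alpha ^- 2.
Proof.
move=> fy; rewrite vec_dot index_sum mulr1 lerD2l -[alpha ^- 2]mulr1.
have a2 : 0 <= alpha ^- 2 by rewrite invr_ge0 sqr_ge0.
apply: le_trans (ler_wpM2l a2 (v_false fy)); rewrite mulr_sumr.
by apply: ler_sum => i _; case: (y i) => /=; rewrite le_eqVlt; apply/orP; left; apply/eqP; field.
Qed.

Lemma start_true x : dot (witness_true x) start_vec = 1.
Proof. by rewrite vec_dot index_sum mulr1 big1 ?addr0 // => i _; rewrite !mulr0 addr0. Qed.

Lemma start_norm : dot start_vec start_vec = 1.
Proof. by rewrite vec_dot index_sum mulr1 big1 ?addr0 // => i _; rewrite !mulr0 addr0. Qed.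

Definition query_mx x : 'M[K]_N :=
  diag_mx (\row_k (query_poly k).@[fun i => (x i)%:R]).

Lemma query_mxE x g : query_mx x *m vec g = vec (fun i => query_sign x i * g i).
Proof. by apply/colP=> k; rewrite mul_diag_mx !mxE query_polyE. Qed.

Lemma query_mx_orth x : (query_mx x)^T *m query_mx x = 1%:M.
Proof.
rewrite tr_diag_mx; apply/matrixP=> k l; rewrite mul_diag_mx !mxE query_polyE.
case: eqP => [_|_]; last by rewrite mulr0n mulr0.
rewrite mulr1n /query_sign; case: (enum_val k) => [_|[i b]]; first by rewrite mulr1.
by rewrite -expr2 sqrr_sign.
Qed.

Lemma query_true x : query_mx x *m witness_true x = witness_true x.
Proof.
rewrite query_mxE; apply/colP=> k; rewrite !mxE; case: (enum_val k) => [_|[i b]] /=.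
  by rewrite mulr1.
by case: (x i) b => [] []; rewrite /= ?mul0r ?mulr0 ?expr0 ?mul1r.
Qed.

Lemma query_false y : start_vec = 2%:R^-1 *: (witness_false y + query_mx y *m witness_false y).
Proof.
rewrite query_mxE; apply/colP=> k; rewrite !mxE; case: (enum_val k) => [_|[i b]] /=.
  by rewrite mulr1 -(natrD _ 1 1) mulVf // pnatr_eq0.
by case: (y i) b => [] []; rewrite /= ?expr0 ?expr1; ring.
Qed.

Lemma walk_bounds : exists S : 'M[K]_N, forall T x,
  let s := (walk_norm_poly S query_poly start_vec T).@[fun i => (x i)%:R] in
  [/\ 0 <= s, s <= T%:R ^+ 2,
      f x -> T%:R ^+ 2 <= (1 + alpha ^+ 2 * n%:R) * s &
      ~~ f x -> s <= 1 + alpha ^- 2].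
Proof.
(* One reflection, independent of the input and of [T], negates every false witness and, by
   orthogonality, fixes every true witness. *)
have [S [ST SS Sneg Sfix]] :=
  reflection_exists [seq witness_false y | y <- enum {: cube} & ~~ f y].
exists S => T x s; rewrite /s walk_norm_polyE -/(query_mx x); set U := query_mx x *m S.
have isoU u w : dot (U *m u) (U *m w) = dot u w.
  rewrite dot_mulmx trmx_mul ST mulmxA -!mulmxA (mulmxA _ (query_mx x)).
  by rewrite query_mx_orth mul1mx !mulmxA SS mul1mx.
split; first exact: dot_ge0.
- exact: (walk_sum_le isoU) start_norm.
- move=> fx; have Uw : U *m witness_true x = witness_true x.
    rewrite -mulmxA Sfix ?query_true // => _ /mapP[y + ->].
    by rewrite mem_filter => /andP[fy _]; apply: witness_orthogonal.
  have := walk_sum_fixed start_vec isoU T Uw; rewrite start_true mulr1 => <-.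
  apply: le_trans (cauchy_schwarz _ _) _.
  by rewrite ler_wpM2r ?dot_ge0 // witness_true_norm.
- move=> fx; apply: le_trans (witness_false_norm fx).
  apply: walk_sum_cobounded isoU _ _ _.
  rewrite -mulmxA Sneg ?mulmxN ?opprK; first exact: query_false.
  by apply/mapP; exists x => //; rewrite mem_filter fx mem_enum.
Qed.

End ApproximateDegreeUpperBound.

Lemma approx_degree_upper_bound n (phi : formula n) : (0 < n)%nat -> read_once phi ->
  exists q : {mpoly R[n]}, approximates q (fun v => feval v phi) /\
    (mdegree q)%:R <= 6%:R * Num.sqrt n%:R :> R.
Proof.
move=> n0 /andP[wf pe].
have uniqL : uniq (fleaves phi) by rewrite (perm_uniq pe) enum_uniq.
have sizeL : size (fleaves phi) = n by rewrite (perm_size pe) size_enum_ord.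
have [v [vt vf vp]] := adversary_read_once R wf uniqL.
have m0 : 0 < n%:R :> R by rewrite ltr0n.
(* With [alpha ^+ 2 = 1 / (2 n)], a true witness has squared norm at most [3/2], which yields
   exactly the threshold [2/3], and a false one at most [1 + 2 n <= 3 n]. *)
pose alpha : R := (Num.sqrt (GRing.mul 2%:R n%:R))^-1.
have a2 : alpha ^- 2 = 2%:R * n%:R by rewrite exprVn invrK sqr_sqrtr // mulr_ge0 ?ler0n.
have a2' : alpha ^+ 2 = (2%:R * n%:R)^-1 by rewrite -a2 invrK.
have alpha0 : alpha != 0 by rewrite invr_eq0 sqrtr_eq0 -ltNge mulr_gt0 ?ltr0n.
have sumL (g : 'I_n -> R) (P : pred 'I_n) : \sum_(i <- fleaves phi | P i) g i = \sum_(i | P i) g i.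
  by rewrite (perm_big _ pe) big_enum_cond.
have vt' (x : {ffun 'I_n -> bool}) : feval x phi -> \sum_i v x i ^+ 2 <= n%:R.
  by move=> fx; rewrite -sumL (le_trans (vt x fx)) // sizeL.
have vf' (y : {ffun 'I_n -> bool}) : ~~ feval y phi -> \sum_i v y i ^+ 2 <= 1.
  by move=> fy; rewrite -sumL vf.
have vp' (x y : {ffun 'I_n -> bool}) : feval x phi -> ~~ feval y phi ->
    \sum_(i | x i != y i) v x i * v y i = 1.
  by move=> fx fy; rewrite -sumL vp.
have [S walkS] := walk_bounds (f := fun x => feval x phi) alpha0 vt' vf' vp'.
(* The least number of states whose square reaches [9 n] brings [3 n] down to a third after
   normalization; minimality bounds the degree [2 T] by [6 sqrt n], since [T] itself falls short. *)
have exT : exists t, (9 * n <= t * t)%nat by exists (9 * n)%nat; rewrite leq_pmulr //; lia.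
case: (ex_minnP exT) => -[|T]; first by lia.
move=> T9 /(_ T) minT; have T9' : (T * T <= 9 * n)%nat by apply: contraT; lia.
have TT0 : 0 < T.+1%:R ^+ 2 :> R by rewrite exprn_gt0 ?ltr0n.
have T9R : 9%:R * n%:R <= T.+1%:R ^+ 2 :> R by rewrite expr2 -!natrM ler_nat.
pose W := walk_norm_poly S (@query_poly R n) (start_vec R n) T.+1.
exists ((T.+1%:R ^+ 2)^-1 *: W); split.
  move=> u /=; pose x : {ffun 'I_n -> bool} := [ffun i => u i].
  (* Inputs of [approximates] are plain functions, while the walk bounds concern finite
     functions. *)
  have -> : u = x by apply: functional_extensionality => i; rewrite ffunE.
  have [s0 s1 st sf] := walkS T.+1 x; rewrite mevalZ -/W in s0 s1 st sf *.
  set s := W.@[_] in s0 s1 st sf *; rewrite [_ * s]mulrC.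
  have n1 : 1 <= n%:R :> R by rewrite ler1n.
  case: ifP => fx; split.
  - have := st fx; rewrite a2' ler_pdivlMr // (_ : 1 + _ = 3%:R / 2%:R); first by lra.
    by field; rewrite gt_eqF.
  - by rewrite ler_pdivrMr // mul1r.
  - by rewrite divr_ge0 // ltW.
  - rewrite ler_pdivrMr //; have := sf (negbT fx); rewrite a2; lra.
have deg : (mdegree ((T.+1%:R ^+ 2)^-1 *: W) <= T.*2)%nat.
  rewrite /mdegree -ltnS; apply: leq_ltn_trans (_ : (T.*2.+1).-1 < _)%nat => //.
  rewrite -!subn1 leq_sub2r // (leq_trans (msizeZ_le _ _)) // msize_walk_norm_poly //.
  exact: msize_query_poly.
apply: le_trans (_ : T.*2%:R <= _); first by rewrite ler_nat.
rewrite -muln2 natrM mulrC (_ : 6%:R * _ = 2%:R * (3%:R * Num.sqrt n%:R)); last by ring.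
rewrite ler_pM2l ?ltr0n // -(ler_pXn2r (n := 2)) ?nnegrE ?ler0n ?mulr_ge0 ?sqrtr_ge0 ?ler0n //.
by rewrite exprMn sqr_sqrtr ?ler0n // !expr2 -!natrM ler_nat.
Qed.

(* c sqrt n <= adeg(f) <= C sqrt n, with adeg(f) the minimum degree of a
   1/3-approximating polynomial: stated as (upper) some approximant has degree
   <= C sqrt n and (lower) every approximant has degree >= c sqrt n. *)
Theorem theorem1p6 :
  exists c C : R, 0 < c /\ 0 < C /\
    forall (n : nat) (phi : formula n), (1 <= n)%nat -> read_once phi ->
      (exists q : {mpoly R[n]},
          approximates q (fun x => feval x phi) /\
          (mdegree q)%:R <= C * Num.sqrt (n%:R)) /\
      (forall q : {mpoly R[n]},
          approximates q (fun x => feval x phi) ->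
          c * Num.sqrt (n%:R) <= (mdegree q)%:R).
Proof.
exists 6%:R^-1, 6%:R; rewrite invr_gt0 !ltr0n; split=> //; split=> // n phi n0 ro; split.
  exact: approx_degree_upper_bound.
move=> q qphi; rewrite ler_pdivrMl ?ltr0n //.
exact: approx_degree_lower_bound ro qphi.
Qed.
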